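(* Let $B=A^{coH}\subseteq A$ be a quantum principal bundle with a complete differential calculus $\Omega^\bullet(A)$. Then $\mathrm{hor}^\bullet(A)$ is a graded algebra: for $\omega\in\mathrm{hor}^k(A)$ and $\gamma\in\mathrm{hor}^\ell(A)$ one has $\omega\wedge\gamma\in\mathrm{hor}^{k+\ell}(A)$.
   Context: Work over a field $\mathbb{k}$; $H$ is a Hopf algebra. A differential calculus on an algebra $A$ is a differential $\mathbb{N}_0$-graded algebra $(\Omega^\bullet,\wedge,\mathrm{d})$ with $\Omega^0=A$ and $\Omega^k=\mathrm{span}\{a^0\mathrm{d}a^1\wedge\cdots\wedge\mathrm{d}a^k\}$. Tensor products of differential graded algebras carry the product $(\omega\otimes\eta)(\omega'\otimes\eta')=(-1)^{|\eta||\omega'|}(\omega\wedge\omega')\otimes(\eta\wedge\eta')$ and the differential $\mathrm{d}\otimes\mathrm{id}+(-1)^{|\cdot|}\mathrm{id}\otimes\mathrm{d}$. Standing assumptions: $\Omega^\bullet(H)$ is the maximal prolongation of a bicovariant first order calculus $(\Gamma,\mathrm{d})$ on $H$ (tensor algebra of $\Gamma$ over $H$ modulo the ideal generated by $\sum_i\mathrm{d}a^i\otimes_H\mathrm{d}b^i$ whenever $\sum_ia^i\mathrm{d}b^i=0$), such that the coproduct extends to a morphism of differential graded algebras $\Omega^\bullet(H)\to\Omega^\bullet(H)\otimes\Omega^\bullet(H)$. A quantum principal bundle is a faithfully flat Hopf-Galois extension $B=A^{coH}\subseteq A$ of a right $H$-comodule algebra $A$. A differential calculus $\Omega^\bullet(A)$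 is complete if $\Delta_A:A\to A\otimes H$ extends to a morphism of differential graded algebras $\Delta_A^\wedge:\Omega^\bullet(A)\to\Omega^\bullet(A)\otimes\Omega^\bullet(H)$. Horizontal forms: $\mathrm{hor}^\bullet(A)=(\Delta_A^\wedge)^{-1}(\Omega^\bullet(A)\otimes H)$, with $\mathrm{hor}^k(A)=\mathrm{hor}^\bullet(A)\cap\Omega^k(A)$. *)

(* Defs.v *)
From HB Require Import structures.
From mathcomp Require Import all_boot all_order all_algebra.
From mathcomp Require Import boolp classical_sets.
From mathcomp Require Import freeg.

Set Implicit Arguments.
Unset Strict Implicit.
Unset Printing Implicit Defensive.

Import GRing.Theory.
Local Open Scope ring_scope.
Local Open Scope quotient_scope.
Local Open Scope classical_set_scope.

Inductive lspan (k : fieldType) (V : lmodType k) (S : set V) : set V :=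
| lspan0 : lspan S 0
| lspan_in x of S x : lspan S x
| lspanL a x y of lspan S x & lspan S y : lspan S (a *: x + y).

Section SpanQuotient.
Variables (k : fieldType) (V : lmodType k) (S : set V).
Implicit Types (x y : V) (a : k).

Lemma lspanZ a x : lspan S x -> lspan S (a *: x).
Proof. by move=> Sx; rewrite -[_ *: _]addr0; apply: lspanL => //; apply: lspan0. Qed.

Lemma lspanD x y : lspan S x -> lspan S y -> lspan S (x + y).
Proof. by move=> Sx Sy; rewrite -[x]scale1r; apply: lspanL. Qed.

Lemma lspan_sum I (r : seq I) (F : I -> V) :
  (forall i, lspan S (F i)) -> lspan S (\sum_(i <- r) F i).
Proof. by move=> SF; elim/big_ind: _ => //; [apply: lspan0|apply: lspanD]. Qed.

Lemma lspan_min (T : set V) : T 0 -> (forall a x y, T x -> T y -> T (a *: x + y)) ->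
  S `<=` T -> lspan S `<=` T.
Proof. by move=> T0 TL ST x; elim=> [//|{}x /ST//|a {}x y _ Tx _ Ty]; apply: TL. Qed.

Definition lspan_pred : {pred V} := fun x => `[< lspan S x >].

Lemma lspan_zmod_closed : zmod_closed lspan_pred.
Proof.
split=> [|x y /asboolP Sx /asboolP Sy]; apply/asboolP; first exact: lspan0.
by rewrite addrC -scaleN1r; apply: lspanL.
Qed.

HB.instance Definition _ := GRing.isZmodClosed.Build V lspan_pred lspan_zmod_closed.

Definition lquot : Type := Quotient.quot lspan_pred.
HB.instance Definition _ := GRing.Zmodule.on lquot.

Definition lqpi : V -> lquot := \pi_(Quotient.quot lspan_pred).
Definition lqrepr (u : lquot) : V := repr (u : Quotient.quot lspan_pred).

Lemma lqreprK : cancel lqrepr lqpi.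
Proof. exact: reprK. Qed.

Lemma lqpi_zmod_morphism : zmod_morphism lqpi.
Proof. exact: pi_is_zmod_morphism. Qed.
HB.instance Definition _ := GRing.isZmodMorphism.Build V lquot lqpi lqpi_zmod_morphism.

Lemma lqpi_eq0 x : lqpi x = 0 <-> lspan S x.
Proof.
rewrite -(raddf0 lqpi) /lqpi; split.
  by move/eqP; rewrite -Quotient.idealrBE subr0 => /asboolP.
by move=> Sx; apply/eqP; rewrite -Quotient.idealrBE subr0; apply/asboolP.
Qed.

Definition lqscale a (u : lquot) : lquot := lqpi (a *: lqrepr u).

Lemma lqpiZ a x : lqpi (a *: x) = lqscale a (lqpi x).
Proof.
apply/subr0_eq; rewrite -raddfB -scalerBr; apply/lqpi_eq0/lspanZ/lqpi_eq0.
by rewrite raddfB /= lqreprK subrr.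
Qed.

Lemma lqscaleA a b u : lqscale a (lqscale b u) = lqscale (a * b) u.
Proof. by rewrite -[u]lqreprK -!lqpiZ scalerA. Qed.
Lemma lqscale1 : left_id 1 lqscale.
Proof. by move=> u; rewrite -[u]lqreprK -lqpiZ scale1r. Qed.
Lemma lqscaleDr : right_distributive lqscale +%R.
Proof.
by move=> a u v; rewrite -[u]lqreprK -[v]lqreprK -raddfD -!lqpiZ scalerDr raddfD.
Qed.
Lemma lqscaleDl u : {morph lqscale^~ u : a b / a + b}.
Proof. by move=> a b; rewrite -[u]lqreprK -!lqpiZ scalerDl raddfD. Qed.

HB.instance Definition _ := GRing.Zmodule_isLmodule.Build k lquot
  lqscaleA lqscale1 lqscaleDr lqscaleDl.

Lemma lqpi_scalable : scalable lqpi.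
Proof. exact: lqpiZ. Qed.
HB.instance Definition _ := GRing.isScalable.Build k V lquot *:%R lqpi lqpi_scalable.

Lemma lqpi_surj (u : lquot) : exists x, u = lqpi x.
Proof. by exists (lqrepr u); rewrite lqreprK. Qed.

(* Only meaningful when [f] is linear and vanishes on [S], see [lqliftE].
   The same convention (a total function whose defining equation needs a
   well-definedness hypothesis) is used for [tlift], [tmap], [tmap2], [btlift]. *)
Definition lqlift (W : Type) (f : V -> W) (u : lquot) : W := f (lqrepr u).

Section Lift.
Variables (W : lmodType k) (f : V -> W).
Hypothesis (fL : linear f) (f0 : forall x, S x -> f x = 0).

Lemma lqliftE x : lqlift f (lqpi x) = f x.
Proof.
pose F : {linear V -> W} := HB.pack f (GRing.isLinear.Build k V W *:%R f fL).
rewrite /lqlift; apply/subr0_eq; rewrite -[f x]/(F x) -[f _]/(F _) -raddfB /=.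
have : lspan S (lqrepr (lqpi x) - x).
  by apply/lqpi_eq0; rewrite raddfB /= lqreprK subrr.
have: lspan S `<=` [set x | F x = 0].
  apply: lspan_min => [|a y z /= y0 z0|y /f0 //]; first exact: (raddf0 F).
  by rewrite -[f _]/(F _) linearP /= y0 z0 scaler0 addr0.
exact.
Qed.

Lemma lqlift_linear : linear (lqlift f).
Proof.
by move=> a u v; rewrite -[u]lqreprK -[v]lqreprK -linearP !lqliftE fL.
Qed.

End Lift.
End SpanQuotient.

Section Functional.
Variables (k : fieldType) (V : lmodType k).

Lemma functional_neq0 (v : V) : v <> 0 -> exists2 f : V -> k^o, linear f & f v = 1.
Proof.
move=> v0.
have [F FP Ftot|A [nAv Amax]] := @Zorn_bigcup V [set A | ~ lspan A v].
  move=> Sv.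
  have sub (X Y : set V) : X `<=` Y -> lspan X `<=` lspan Y.
    by move=> XY x; elim=> [|{}x /XY|a {}x y _ + _]; [exact: lspan0|exact: lspan_in|exact: lspanL].
  have : lspan (\bigcup_(X in F) X) `<=` [set x | x = 0 \/ exists2 X, F X & lspan X x].
    apply: lspan_min => [|a x y|x [X FX Xx]]; first by left.
      case=> [->|[X FX Xx]] [->|[Y FY Yy]].
      - by left; rewrite scaler0 addr0.
      - by right; exists Y => //; rewrite scaler0 add0r.
      - by right; exists X => //; rewrite addr0; apply: lspanZ.
      right; have [XY|YX] := Ftot _ _ FX FY.
        by exists Y => //; apply: lspanL => //; apply: sub Xx.
      by exists X => //; apply: lspanL => //; apply: sub Yy.
    by right; exists X => //; apply: lspan_in.
  by move=> /(_ v Sv)[//|[X FX Xv]]; apply: FP FX Xv.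
have coef x : exists c : k, lspan A (x - c *: v).
  have [Ax|nAx] := pselect (lspan A x); first by exists 0; rewrite scale0r subr0.
  have : lspan (A `|` [set x]) v.
    apply: contrapT; apply: Amax; split; first by left.
    by move=> /(_ x (or_intror erefl)) Ax; apply/nAx/lspan_in.
  have : lspan (A `|` [set x]) `<=` [set y | exists c, lspan A (y - c *: x)].
    apply: lspan_min => [|a y z [c yc] [d zd]|y [Ay|->]].
    - by exists 0; rewrite scale0r subr0; apply: lspan0.
    - exists (a * c + d); suff -> : a *: y + z - (a * c + d) *: x =
        a *: (y - c *: x) + (z - d *: x) by apply: lspanL.
      by rewrite scalerBr scalerA scalerDl opprD addrACA.
    - by exists 0; rewrite scale0r subr0; apply: lspan_in.
    - by exists 1; rewrite scale1r subrr; apply: lspan0.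
  move=> /[swap] Av /(_ _ Av)[c vc].
  have c0 : c != 0.
    by apply/eqP => c0; apply: nAv; move: vc; rewrite c0 scale0r subr0.
  exists c^-1; suff -> : x - c^-1 *: v = (- c^-1) *: (v - c *: x) by apply: lspanZ.
  by rewrite scalerBr !scaleNr scalerA mulVf// scale1r opprK addrC.
have uniqc x c d : lspan A (x - c *: v) -> lspan A (x - d *: v) -> c = d.
  move=> xc xd; apply: contrapT => /eqP cd; apply: nAv.
  have: lspan A (-1 *: (x - c *: v) + (x - d *: v)) by apply: lspanL.
  rewrite scaleN1r opprB addrA subrK -scalerBl => /(lspanZ (c - d)^-1).
  by rewrite scalerA mulVf ?scale1r// subr_eq0.
pose f x : k^o := sval (cid (coef x)).
have fP x : lspan A (x - f x *: v) by rewrite /f; case: cid.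
exists f => [a x y|].
  apply: (uniqc (a *: x + y)) => //.
  suff -> : a *: x + y - (a *: f x + f y) *: v =
    a *: (x - f x *: v) + (y - f y *: v) by apply: lspanL.
  by rewrite scalerBr scalerA scalerDl opprD addrACA.
by apply: (uniqc v) => //; rewrite scale1r subrr; apply: lspan0.
Qed.

End Functional.

Definition bilin (k : fieldType) (U V W : lmodType k) (f : U -> V -> W) : Prop :=
  (forall v, linear (f^~ v)) /\ (forall u, linear (f u)).

Section FreeLift.
Variables (k : fieldType) (K : choiceType) (W : lmodType k) (f : K -> W).
Lemma fglift_linear : linear (fglift f : {freeg K / k} -> W).
Proof.
pose F : {additive {freeg K / k} -> W} := HB.pack (fglift f : {freeg K / k} -> W)
  (GRing.isAdditive.Build _ _ _ (lift_is_additive f)).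
have FZ a D : F (a *: D) = a *: F D.
  have -> : F D = \sum_(x <- dom D) F << coeff x D *g x >>.
    by rewrite -raddf_sum freeg_sumE.
  rewrite [a *: D]/(fgscale a D) /fgscale raddf_sum scaler_sumr.
  by apply: eq_bigr => x _; rewrite /= !liftU scalerA.
by move=> a x y; rewrite -[LHS]/(F _) raddfD FZ.
Qed.
End FreeLift.

Section Tensor.
Variables (k : fieldType) (U V : lmodType k).

Local Notation fg u v := (<< (u, v) >> : {freeg (U * V) / k}).

(* U (x) V is the free module on pairs modulo bilinearity; U and V are
   arbitrary vector spaces, not assumed finite dimensional. *)
Inductive tens_rel : set {freeg (U * V) / k} :=
| tens_rell a u u' v : tens_rel (fg (a *: u + u') v - (a *: fg u v + fg u' v))
| tens_relr a u v v' : tens_rel (fg u (a *: v + v') - (a *: fg u v + fg u v')).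

Definition tensor : Type := lquot tens_rel.
HB.instance Definition _ := GRing.Lmodule.on tensor.

Definition tens (u : U) (v : V) : tensor := lqpi tens_rel << (u, v) >>.

Lemma tens_linearl v : linear (tens^~ v).
Proof.
move=> a u u'; rewrite /tens -linearP /=; apply/subr0_eq; rewrite -raddfB.
by apply/lqpi_eq0/lspan_in/tens_rell.
Qed.
Lemma tens_linearr u : linear (tens u).
Proof.
move=> a v v'; rewrite /tens -linearP /=; apply/subr0_eq; rewrite -raddfB.
by apply/lqpi_eq0/lspan_in/tens_relr.
Qed.

Definition tlift (W : lmodType k) (f : U -> V -> W) : tensor -> W :=
  lqlift (fglift (fun p => f p.1 p.2)).

Section Lift.
Variables (W : lmodType k) (f : U -> V -> W).
Hypothesis fB : bilin f.

Let f0 x : tens_rel x -> fglift (fun p => f p.1 p.2) x = 0.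
Proof.
have gL := fglift_linear (fun p : U * V => f p.1 p.2).
pose g : {linear {freeg (U * V) / k} -> W} := HB.pack (fglift (fun p : U * V => f p.1 p.2))
  (GRing.isLinear.Build _ _ _ *:%R (fglift (fun p : U * V => f p.1 p.2)) gL).
case=> [a u u' v|a u v v']; rewrite -[LHS]/(g _) linearB (linearP g) /= !liftU !scale1r /=.
  by rewrite (fB.1 v) subrr.
by rewrite (fB.2 u) subrr.
Qed.

Lemma tlift_linear : linear (tlift f).
Proof. exact: lqlift_linear (fglift_linear _) f0. Qed.

Lemma tliftE u v : tlift f (tens u v) = f u v.
Proof. by rewrite /tlift /tens lqliftE ?liftU ?scale1r//; apply: fglift_linear. Qed.

End Lift.

Lemma tensor_ind (P : tensor -> Prop) :
  P 0 -> (forall x y, P x -> P y -> P (x + y)) -> (forall u v, P (tens u v)) ->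
  forall x, P x.
Proof.
move=> P0 PD Pt x; have [D ->] := lqpi_surj x.
elim/freeg_ind_dom0: D => [|a [u v] D _ _ PD']; first by rewrite raddf0.
rewrite linearD; apply: PD => //.
have -> : << a *g (u, v) >> = a *: << (u, v) >> :> {freeg (U * V) / k}.
  by apply/eqP/freeg_eqP => z; rewrite coeffZ !coeffU mul1r.
rewrite linearZ /= -/(tens u v).
have -> : a *: tens u v = tens (a *: u) v; last exact: Pt.
have := tens_linearl v a u 0; rewrite addr0 => ->.
have := tens_linearl v (-1) 0 0; rewrite scaler0 addr0 scaleN1r addNr => ->.
by rewrite addr0.
Qed.

End Tensor.

Notation "u ⊗ v" := (tens u v) (at level 40, left associativity) : ring_scope.

Section Linear.
Variables (k : fieldType) (U V W : lmodType k).

Lemma linear_id : linear (@id U). Proof. by []. Qed.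

Lemma linear_comp (f : V -> W) (g : U -> V) :
  linear f -> linear g -> linear (f \o g).
Proof. by move=> fL gL a x y /=; rewrite gL fL. Qed.

Lemma linfunD (f : U -> V) : linear f -> {morph f : x y / x + y}.
Proof. by move=> fL x y; rewrite -[x]scale1r fL !scale1r. Qed.

Lemma linfun0 (f : U -> V) : linear f -> f 0 = 0.
Proof. by move=> fL; apply: (addrI (f 0)); rewrite -linfunD// !addr0. Qed.

Lemma linfunZ (f : U -> V) : linear f -> scalable f.
Proof. by move=> fL a x; rewrite -[a *: x]addr0 fL linfun0// addr0. Qed.

Lemma linfun_sum (f : U -> V) I (r : seq I) (P : pred I) (F : I -> U) : linear f ->
  f (\sum_(i <- r | P i) F i) = \sum_(i <- r | P i) f (F i).
Proof. by move=> fL; apply: (big_morph f (linfunD fL) (linfun0 fL)). Qed.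

Lemma sum_linear I (r : seq I) (P : pred I) (F : I -> U -> V) :
  (forall i, linear (F i)) -> linear (fun u => \sum_(i <- r | P i) F i u).
Proof.
move=> FL a x y; rewrite scaler_sumr -big_split /=.
by apply: eq_bigr => i _; rewrite FL.
Qed.

Lemma linear_scale (c : k) (f : U -> V) : linear f -> linear (fun u => c *: f u).
Proof. by move=> fL a x y; rewrite fL scalerDr !scalerA mulrC. Qed.

Lemma linear_add (f g : U -> V) :
  linear f -> linear g -> linear (fun u => f u + g u).
Proof. by move=> fL gL a x y; rewrite fL gL scalerDr addrACA. Qed.

Lemma eq_linear (f g : U -> V) : f =1 g -> linear f -> linear g.
Proof. by move=> fg fL a x y; rewrite -!fg fL. Qed.

End Linear.

Section Bilin.
Variables (k : fieldType) (U V W : lmodType k) (f : U -> V -> W).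
Hypothesis fB : bilin f.

Lemma bilinDl v : {morph f^~ v : x y / x + y}. Proof. exact: linfunD (fB.1 v). Qed.
Lemma bilinDr u : {morph f u : x y / x + y}. Proof. exact: linfunD (fB.2 u). Qed.
Lemma bilinZl a u v : f (a *: u) v = a *: f u v. Proof. exact: (linfunZ (fB.1 v)). Qed.
Lemma bilinZr a u v : f u (a *: v) = a *: f u v. Proof. exact: (linfunZ (fB.2 u)). Qed.
Lemma bilin0l v : f 0 v = 0. Proof. exact: (linfun0 (fB.1 v)). Qed.
Lemma bilin0r u : f u 0 = 0. Proof. exact: (linfun0 (fB.2 u)). Qed.
Lemma bilin_suml I (r : seq I) (P : pred I) (F : I -> U) v :
  f (\sum_(i <- r | P i) F i) v = \sum_(i <- r | P i) f (F i) v.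
Proof. exact: (linfun_sum _ _ _ (fB.1 v)). Qed.
Lemma bilin_sumr I (r : seq I) (P : pred I) (F : I -> V) u :
  f u (\sum_(i <- r | P i) F i) = \sum_(i <- r | P i) f u (F i).
Proof. exact: (linfun_sum _ _ _ (fB.2 u)). Qed.

End Bilin.

Section TensorMaps.
Variable k : fieldType.
Implicit Types U V W : lmodType k.

Lemma tens_bilin U V : bilin (@tens k U V).
Proof. by split; [apply: tens_linearl|apply: tens_linearr]. Qed.

Lemma bilin_comp U U' V V' W (f : U' -> V' -> W) (g : U -> U') (h : V -> V') :
  bilin f -> linear g -> linear h -> bilin (fun u v => f (g u) (h v)).
Proof. by move=> fB gL hL; split=> [v|u] a x y; rewrite ?gL ?hL ?fB.1 ?fB.2. Qed.

Lemma linear_bilin U V W W' (f : U -> V -> W) (g : W -> W') :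
  linear g -> bilin f -> bilin (fun u v => g (f u v)).
Proof. by move=> gL fB; split=> [v|u] a x y; rewrite ?fB.1 ?fB.2 gL. Qed.

Lemma tensor_ext U V W (f g : tensor U V -> W) : linear f -> linear g ->
  (forall u v, f (u ⊗ v) = g (u ⊗ v)) -> f =1 g.
Proof.
move=> fL gL fg; apply: tensor_ind => [|x y fx fy|//]; first by rewrite !linfun0.
by rewrite !linfunD// fx fy.
Qed.

Lemma tlift_ext U V W (f g : U -> V -> W) : bilin f ->
  (forall u v, f u v = g u v) -> tlift f =1 tlift g.
Proof.
by move=> fB fg x; congr (tlift _ x); apply/funext => u; apply/funext => v.
Qed.

Definition tmap U U' V V' (f : U -> V) (g : U' -> V') : tensor U U' -> tensor V V' :=
  tlift (fun u u' => f u ⊗ g u').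

Lemma tmap_linear U U' V V' (f : U -> V) (g : U' -> V') :
  linear f -> linear g -> linear (tmap f g).
Proof. by move=> fL gL; apply: tlift_linear; apply: bilin_comp (tens_bilin _ _) fL gL. Qed.

Lemma tmapE U U' V V' (f : U -> V) (g : U' -> V') u u' :
  linear f -> linear g -> tmap f g (u ⊗ u') = f u ⊗ g u'.
Proof. by move=> fL gL; apply: tliftE; apply: bilin_comp (tens_bilin _ _) fL gL. Qed.

Definition tmap2 U U' V V' W W' (f : U -> V -> W) (g : U' -> V' -> W')
    (x : tensor U U') (y : tensor V V') : tensor W W' :=
  tlift (fun u u' => tmap (f u) (g u') y) x.

Section Tmap2.
Variables (U U' V V' W W' : lmodType k) (f : U -> V -> W) (g : U' -> V' -> W').
Hypotheses (fB : bilin f) (gB : bilin g).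

Let in_bilin y : bilin (fun u u' => tmap (f u) (g u') y).
Proof.
split=> [u'|u] a x z.
  move: y; apply: tensor_ext => [||v v'].
  - exact: tmap_linear (fB.2 _) (gB.2 _).
  - by apply: linear_add; first apply: linear_scale; apply: tmap_linear (fB.2 _) (gB.2 _).
  - rewrite !tmapE; do ?[exact: fB.2|exact: gB.2].
    by rewrite fB.1 (tens_bilin _ _).1.
move: y; apply: tensor_ext => [||v v'].
- exact: tmap_linear (fB.2 _) (gB.2 _).
- by apply: linear_add; first apply: linear_scale; apply: tmap_linear (fB.2 _) (gB.2 _).
- rewrite !tmapE; do ?[exact: fB.2|exact: gB.2].
  by rewrite gB.1 (tens_bilin _ _).2.
Qed.

Lemma tmap2E u u' v v' : tmap2 f g (u ⊗ u') (v ⊗ v') = f u v ⊗ g u' v'.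
Proof.
rewrite /tmap2 tliftE ?tmapE//; do ?[exact: fB.2|exact: gB.2]; exact: in_bilin.
Qed.

Lemma tmap2_bilin : bilin (tmap2 f g).
Proof.
split=> [y|x]; first exact: tlift_linear (in_bilin y).
move=> a y z; move: x; apply: tensor_ext => [||u u'].
- exact: tlift_linear (in_bilin _).
- by apply: linear_add; first apply: linear_scale; apply: tlift_linear (in_bilin _).
- rewrite /tmap2 !tliftE; do ?[exact: in_bilin].
  by rewrite tmap_linear; do ?[exact: fB.2|exact: gB.2].
Qed.

End Tmap2.

Lemma tens11_neq0 U V (u : U) (v : V) : u <> 0 -> v <> 0 -> u ⊗ v <> 0.
Proof.
move=> /functional_neq0[f fL fu] /functional_neq0[g gL gv] uv0.
have B : bilin (fun x y => f x * g y : k^o).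
  split=> [y|x] a p q; first by rewrite fL mulrDl scalerAl.
  by rewrite gL mulrDr /GRing.scale /= mulrCA.
have := tliftE B u v; rewrite uv0 linfun0; last exact: tlift_linear.
by rewrite fu gv mulr1 => /esym/eqP; rewrite oner_eq0.
Qed.

End TensorMaps.

Section TensorAlgebra.
Variables (k : fieldType) (A B : algType k).

Lemma mul_bilin (C : algType k) : bilin (@GRing.mul C).
Proof.
by split=> [v|u] a x y; [rewrite mulrDl -scalerAl|rewrite mulrDr -scalerAr].
Qed.

Definition tmul : tensor A B -> tensor A B -> tensor A B := tmap2 *%R *%R.
Let tmulB : bilin tmul := tmap2_bilin (mul_bilin _) (mul_bilin _).
Let tmulE a b a' b' : tmul (a ⊗ b) (a' ⊗ b') = (a * a') ⊗ (b * b').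
Proof. by apply: tmap2E; apply: mul_bilin. Qed.

Lemma tmulA : associative tmul.
Proof.
move=> x y z; elim/tensor_ind: x => [|x x' IH IH'|a b].
- by rewrite !(bilin0l tmulB).
- by rewrite !(bilinDl tmulB) IH IH'.
elim/tensor_ind: y => [|y y' IH IH'|a' b'].
- by rewrite !(bilin0l tmulB, bilin0r tmulB).
- by rewrite (bilinDl tmulB) !(bilinDr tmulB) (bilinDl tmulB) IH IH'.
elim/tensor_ind: z => [|z z' IH IH'|a'' b''].
- by rewrite !(bilin0r tmulB).
- by rewrite !(bilinDr tmulB) IH IH'.
by rewrite !tmulE !mulrA.
Qed.

Lemma tmul1 : left_id (1 ⊗ 1) tmul.
Proof.
elim/tensor_ind => [|x x' IH IH'|a b]; first exact: (bilin0r tmulB).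
  by rewrite (bilinDr tmulB) IH IH'.
by rewrite tmulE !mul1r.
Qed.

Lemma tmulr1 : right_id (1 ⊗ 1) tmul.
Proof.
elim/tensor_ind => [|x x' IH IH'|a b]; first exact: (bilin0l tmulB).
  by rewrite (bilinDl tmulB) IH IH'.
by rewrite tmulE !mulr1.
Qed.

Lemma tmulDl : left_distributive tmul +%R.
Proof. by move=> x y z; rewrite (bilinDl tmulB). Qed.
Lemma tmulDr : right_distributive tmul +%R.
Proof. by move=> x y z; rewrite (bilinDr tmulB). Qed.

Lemma tone_neq0 : (1 : A) ⊗ (1 : B) != 0.
Proof. by apply/eqP/tens11_neq0; apply/eqP/oner_neq0. Qed.

HB.instance Definition _ := GRing.Zmodule_isNzRing.Build (tensor A B)
  tmulA tmul1 tmulr1 tmulDl tmulDr tone_neq0.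
HB.instance Definition _ := GRing.Lmodule_isLalgebra.Build k (tensor A B)
  (fun a x y => esym (bilinZl tmulB a x y)).
HB.instance Definition _ := GRing.Lalgebra_isAlgebra.Build k (tensor A B)
  (fun a x y => esym (bilinZr tmulB a x y)).

Lemma tensM (a a' : A) (b b' : B) : (a ⊗ b) * (a' ⊗ b') = (a * a') ⊗ (b * b').
Proof. exact: tmulE. Qed.

Lemma tens1 : 1 = (1 : A) ⊗ (1 : B). Proof. by []. Qed.

End TensorAlgebra.

(* A grading A = (+)_n A^n is given by its projections hcomp n : A -> A^n.
   By [hcompK], x = \sum_(n < N) hcomp n x also says that only finitely many
   components of x are nonzero. *)
HB.mixin Record isGradedAlgebra (k : fieldType) A of GRing.Algebra k A := {
  hcomp : nat -> A -> A;
  hcomp_linear : forall n, linear (hcomp n);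
  hcompK : forall m n x, hcomp m (hcomp n x) = if m == n then hcomp n x else 0;
  hcomp_sum : forall x, exists N, x == \sum_(n < N) hcomp n x;
  hcomp1 : hcomp 0 1 = 1;
  hcompM : forall m n x y,
    hcomp (m + n) (hcomp m x * hcomp n y) = hcomp m x * hcomp n y
}.
#[short(type="gradedAlgType")]
HB.structure Definition GradedAlgebra (k : fieldType) :=
  {A of GRing.Algebra k A & isGradedAlgebra k A}.

HB.mixin Record isDGAlgebra (k : fieldType) A of GradedAlgebra k A := {
  dif : A -> A;
  dif_linear : linear dif;
  dif_hcomp : forall n x, hcomp n.+1 (dif (hcomp n x : A)) = dif (hcomp n x);
  dif_dif : forall x, dif (dif x) = 0;
  dif_leibniz : forall n x y,
    dif ((hcomp n x : A) * y) = dif (hcomp n x) * y + (-1) ^+ n *: (hcomp n x * dif y)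
}.
#[short(type="dgAlgType")]
HB.structure Definition DGAlgebra (k : fieldType) :=
  {A of GradedAlgebra k A & isDGAlgebra k A}.

Section GradedTheory.
Variables (k : fieldType) (A : gradedAlgType k).
Implicit Types x y : A.

Definition homog (n : nat) : set A := [set x | hcomp n x = x].

Lemma hcomp_homog n x : homog n (hcomp n x).
Proof. by rewrite /homog /= hcompK eqxx. Qed.

Lemma homog_hcomp m n x : homog n x -> hcomp m x = if m == n then x else 0.
Proof. by move=> <-; rewrite hcompK. Qed.

Lemma homogM m n x y : homog m x -> homog n y -> homog (m + n) (x * y).
Proof. by move=> <- <-; rewrite /homog /= hcompM. Qed.

Lemma homog1 : homog 0 (1 : A). Proof. exact: hcomp1. Qed.

(* The least N such that all components of x of degree >= N vanish. *)
Definition gbound x : nat := ex_minn (hcomp_sum x).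

Lemma gboundP x : x = \sum_(n < gbound x) hcomp n x.
Proof. by rewrite /gbound; case: ex_minnP => n /eqP. Qed.

Lemma hcomp_eq0 n x : (gbound x <= n)%N -> hcomp n x = 0.
Proof.
move=> xn; rewrite [in LHS](gboundP x) (linfun_sum _ _ _ (hcomp_linear n)) big1// => i _.
by rewrite hcompK; case: eqP => // ni; have := ltn_ord i; rewrite -ni ltnNge xn.
Qed.

Lemma homog_ind (P : A -> Prop) : P 0 -> (forall x y, P x -> P y -> P (x + y)) ->
  (forall n x, homog n x -> P x) -> forall x, P x.
Proof.
move=> P0 PD Ph x; rewrite [x]gboundP; elim/big_ind: _ => // i _.
exact/Ph/hcomp_homog.
Qed.

Definition gsum (W : lmodType k) (F : nat -> A -> W) x : W :=
  \sum_(n < gbound x) F n (hcomp n x).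

Section Gsum.
Variables (W : lmodType k) (F : nat -> A -> W).
Hypothesis FL : forall n, linear (F n).

Lemma gsum_widen x N : (gbound x <= N)%N -> gsum F x = \sum_(n < N) F n (hcomp n x).
Proof.
move=> xN; rewrite /gsum (big_ord_widen _ (fun n => F n (hcomp n x)) xN) big_mkcond.
apply: eq_bigr => i _; case: ltnP => // xi.
by rewrite hcomp_eq0// (linfun0 (FL i)).
Qed.

Lemma gsum_linear : linear (gsum F).
Proof.
move=> a x y.
pose N := maxn (maxn (gbound x) (gbound y)) (gbound (a *: x + y)).
rewrite !(@gsum_widen _ N) ?leq_max ?leqnn ?orbT// scaler_sumr -big_split /=.
by apply: eq_bigr => i _; rewrite hcomp_linear FL.
Qed.

Lemma gsum_homog n x : homog n x -> gsum F x = F n x.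
Proof.
move=> xn; rewrite (@gsum_widen _ (maxn (gbound x) n.+1)) ?leq_maxl//.
have nN : (n < maxn (gbound x) n.+1)%N by rewrite leq_max leqnn orbT.
rewrite (bigD1 (Ordinal nN)) //= xn big1 ?addr0// => i /eqP ni.
rewrite (homog_hcomp _ xn); case: eqP => [ein|_]; last exact: (linfun0 (FL i)).
by case: ni; apply/val_inj.
Qed.

End Gsum.

Lemma gsum_linear2 (U W : lmodType k) (F : U -> nat -> A -> W) x :
  (forall n x, linear (fun u => F u n x)) -> linear (fun u => gsum (F u) x).
Proof. by rewrite /gsum => FL; apply: sum_linear => i; apply: FL. Qed.

End GradedTheory.

(* A (x) B with the Koszul-signed product, as opposed to the unsigned algebra
   structure carried by [tensor A B]. *)
Definition gtensor (k : fieldType) (A B : dgAlgType k) : Type := tensor A B.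

Section GradedTensor.
Variables (k : fieldType) (A B : dgAlgType k).
Local Notation T := (gtensor A B).
Implicit Types (a : A) (b : B) (x y : T).

HB.instance Definition _ := GRing.Lmodule.on T.

Definition gtens a b : T := a ⊗ b.

Let gtensB : bilin gtens. Proof. exact: tens_bilin. Qed.

Lemma gtensor_ind (P : T -> Prop) :
  P 0 -> (forall x y, P x -> P y -> P (x + y)) ->
  (forall p q a b, homog p a -> homog q b -> P (gtens a b)) ->
  forall x, P x.
Proof.
move=> P0 PD Ph; apply: tensor_ind => // a b; rewrite -/(gtens a b).
elim/homog_ind: a => [|a a' IH IH'|p a ap]; first by rewrite (bilin0l gtensB).
  by rewrite (bilinDl gtensB); apply: PD.
elim/homog_ind: b => [|b b' IH IH'|q b bq]; first by rewrite (bilin0r gtensB).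
  by rewrite (bilinDr gtensB); apply: PD.
exact: Ph ap bq.
Qed.

Lemma gtensor_ext (W : lmodType k) (f g : T -> W) : linear f -> linear g ->
  (forall p q a b, homog p a -> homog q b -> f (gtens a b) = g (gtens a b)) ->
  f =1 g.
Proof.
move=> fL gL fg; apply: gtensor_ind => [|x y fx fy|//]; first by rewrite !linfun0.
by rewrite !linfunD// fx fy.
Qed.

(* (a (x) b)(a' (x) b') = \sum_(q, r) (-1)^(q r) (a a'_r) (x) (b_q b'), the sum
   running over the homogeneous components b_q of b and a'_r of a'; see [gtensM]. *)
Definition gtmul_pure a b a' b' : T :=
  gsum (fun q b => gsum (fun r a' =>
    (-1) ^+ (q * r) *: gtens (a * a') (b * b')) a') b.

Definition gtmul x y : T :=
  tlift (fun a b => tlift (gtmul_pure a b) y : T) x.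

Let mulB (C : algType k) : bilin (@GRing.mul C) := mul_bilin C.

Let pureL3 q b r b' a : linear (fun a' : A => (-1) ^+ (q * r) *: gtens (a * a') (b * b')).
Proof.
apply: linear_scale => c u v.
by rewrite (mulB A).2 gtensB.1.
Qed.

Let pure_linear1 b a' b' : linear (fun a => gtmul_pure a b a' b').
Proof.
apply: gsum_linear2 => q b0; apply: gsum_linear2 => r a0.
by apply: linear_scale => c u v; rewrite (mulB A).1 gtensB.1.
Qed.

Let pure_linear2 a a' b' : linear (fun b => gtmul_pure a b a' b').
Proof.
apply: gsum_linear => q; apply: gsum_linear2 => r a0.
by apply: linear_scale => c u v; rewrite (mulB B).1 gtensB.2.
Qed.

Let pure_linear3 a b b' : linear (fun a' => gtmul_pure a b a' b').
Proof.
by apply: gsum_linear2 => q b0; apply: gsum_linear => r; apply: pureL3.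
Qed.

Let pure_linear4 a b a' : linear (fun b' => gtmul_pure a b a' b').
Proof.
apply: gsum_linear2 => q b0; apply: gsum_linear2 => r a0.
by apply: linear_scale => c u v; rewrite (mulB B).2 gtensB.2.
Qed.

Let pureB a b : bilin (gtmul_pure a b).
Proof. by split=> [b'|a']; [apply: pure_linear3|apply: pure_linear4]. Qed.

Let tlift_pureB y : bilin (fun a b => tlift (gtmul_pure a b) y : T).
Proof.
have L a b : linear (tlift (gtmul_pure a b) : tensor A B -> T) by exact: tlift_linear.
have LL c a b a' b' : linear (fun y : tensor A B =>
    c *: (tlift (gtmul_pure a b) y : T) + tlift (gtmul_pure a' b') y).
  by apply: linear_add => //; apply: linear_scale.
split=> [b|a] c u v; move: y; apply: tensor_ext => // a' b'; rewrite !tliftE//.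
  by rewrite pure_linear1.
by rewrite pure_linear2.
Qed.

Let gtmulB : bilin gtmul.
Proof.
split=> [y|x]; first exact: tlift_linear.
move=> c y z; move: x; apply: tensor_ext => [||a b].
- exact: tlift_linear.
- by apply: linear_add; first apply: linear_scale; apply: tlift_linear.
by rewrite /gtmul !tliftE// tlift_linear.
Qed.

Let gtmulE q r a b a' b' : homog q b -> homog r a' ->
  gtmul (gtens a b) (gtens a' b') = (-1) ^+ (q * r) *: gtens (a * a') (b * b').
Proof.
move=> bq ar; rewrite /gtmul /gtens !tliftE// /gtmul_pure.
rewrite (gsum_homog _ bq) => [|n]; last first.
  apply: gsum_linear2 => i a0.
  by apply: linear_scale => c u v; rewrite (mulB B).1 gtensB.2.
by rewrite (gsum_homog _ ar)// => n; apply: pureL3.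
Qed.

Let sgnrE (m n : nat) : odd m = odd n -> (-1) ^+ m = (-1) ^+ n :> k.
Proof. by rewrite -signr_odd => ->; rewrite signr_odd. Qed.

Lemma gtmulA : associative gtmul.
Proof.
move=> x y z; elim/gtensor_ind: x => [|x x' IH IH'|p q a b ap bq].
- by rewrite !(bilin0l gtmulB).
- by rewrite !(bilinDl gtmulB) IH IH'.
elim/gtensor_ind: y => [|y y' IH IH'|p' q' a' b' ap' bq'].
- by rewrite !(bilin0l gtmulB, bilin0r gtmulB).
- by rewrite (bilinDl gtmulB) !(bilinDr gtmulB) (bilinDl gtmulB) IH IH'.
elim/gtensor_ind: z => [|z z' IH IH'|p'' q'' a'' b'' ap'' bq''].
- by rewrite !(bilin0r gtmulB).
- by rewrite !(bilinDr gtmulB) IH IH'.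
rewrite (gtmulE _ _ bq' ap'') (gtmulE _ _ bq ap').
rewrite (bilinZl gtmulB) (bilinZr gtmulB).
rewrite (gtmulE _ _ bq (homogM ap' ap'')) (gtmulE _ _ (homogM bq bq') ap'').
rewrite !scalerA -!exprD !mulrA; congr (_ *: _); apply: sgnrE.
by rewrite !(oddD, oddM); case: (odd q); case: (odd q'); case: (odd p'); case: (odd p'').
Qed.

Lemma gtmul1 : left_id (gtens 1 1) gtmul.
Proof.
elim/gtensor_ind => [|x x' IH IH'|p q a b ap bq]; first exact: (bilin0r gtmulB).
  by rewrite (bilinDr gtmulB) IH IH'.
by rewrite (gtmulE _ _ (homog1 B) ap) !mul1r mul0n expr0 scale1r.
Qed.

Lemma gtmulr1 : right_id (gtens 1 1) gtmul.
Proof.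
elim/gtensor_ind => [|x x' IH IH'|p q a b ap bq]; first exact: (bilin0l gtmulB).
  by rewrite (bilinDl gtmulB) IH IH'.
by rewrite (gtmulE _ _ bq (homog1 A)) !mulr1 muln0 expr0 scale1r.
Qed.

Lemma gtmulDl : left_distributive gtmul +%R.
Proof. by move=> x y z; rewrite (bilinDl gtmulB). Qed.
Lemma gtmulDr : right_distributive gtmul +%R.
Proof. by move=> x y z; rewrite (bilinDr gtmulB). Qed.

Lemma gtone_neq0 : gtens 1 1 != 0.
Proof. by apply/eqP/tens11_neq0; apply/eqP/oner_neq0. Qed.

HB.instance Definition _ := GRing.Zmodule_isNzRing.Build T
  gtmulA gtmul1 gtmulr1 gtmulDl gtmulDr gtone_neq0.
HB.instance Definition _ := GRing.Lmodule_isLalgebra.Build k T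
  (fun c x y => esym (bilinZl gtmulB c x y)).
HB.instance Definition _ := GRing.Lalgebra_isAlgebra.Build k T
  (fun c x y => esym (bilinZr gtmulB c x y)).

Lemma gtensM q r a b a' b' : homog q b -> homog r a' ->
  gtens a b * gtens a' b' = (-1) ^+ (q * r) *: gtens (a * a') (b * b').
Proof. exact: gtmulE. Qed.

Definition gthcomp (n : nat) x : T :=
  tlift (fun a b => \sum_(i < n.+1) gtens (hcomp i a) (hcomp (n - i) b)) x.

Let gthcompB n : bilin (fun a b => \sum_(i < n.+1) gtens (hcomp i a) (hcomp (n - i) b)).
Proof.
split=> [b|a]; apply: sum_linear => i c u v; first by rewrite hcomp_linear gtensB.1.
by rewrite hcomp_linear gtensB.2.
Qed.

Lemma gthcomp_linear n : linear (gthcomp n).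
Proof. exact: tlift_linear. Qed.

Lemma gthcomp_gtens n p q a b : homog p a -> homog q b ->
  gthcomp n (gtens a b) = if n == (p + q)%N then gtens a b else 0.
Proof.
move=> ap bq; rewrite /gthcomp tliftE//.
transitivity (\sum_(i < n.+1) if (i == p :> nat) && (n == p + q)%N then gtens a b else 0).
  apply: eq_bigr => i _; rewrite (homog_hcomp _ ap) (homog_hcomp _ bq).
  case: eqP => [<-|_] /=; last exact: (bilin0l gtensB).
  have -> : (n - i == q)%N = (n == i + q)%N.
    by rewrite -(eqn_add2l i) subnKC// -ltnS.
  by case: ifP => // _; exact: (bilin0r gtensB).
case: eqP => [->|_]; last by rewrite big1// => i _; rewrite andbF.
have pn : (p < (p + q).+1)%N by rewrite ltnS leq_addr.
rewrite (bigD1 (Ordinal pn))//= eqxx big1 ?addr0// => i /eqP ip.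
by case: eqP => // ipE; case: ip; apply/val_inj.
Qed.

Lemma gthcompK m n x :
  gthcomp m (gthcomp n x) = if m == n then gthcomp n x else 0.
Proof.
elim/gtensor_ind: x => [|x y IH IH'|p q a b ap bq].
- by rewrite !(linfun0 (gthcomp_linear _)) if_same.
- by rewrite !(linfunD (gthcomp_linear _)) IH IH'; case: ifP; rewrite ?addr0.
rewrite !(gthcomp_gtens _ ap bq); case: (n =P (p + q)%N) => [->|_].
  by rewrite (gthcomp_gtens _ ap bq).
by rewrite (linfun0 (gthcomp_linear _)) if_same.
Qed.

Lemma gthcomp_sum x : exists N, x == \sum_(n < N) gthcomp n x.
Proof.
suff [N xN] : exists N, forall M, (N <= M)%N -> x == \sum_(n < M) gthcomp n x.
  by exists N; apply: xN.
elim/gtensor_ind: x => [|x y [N xN] [M yM]|p q a b ap bq].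
- by exists 0%N => M _; rewrite big1// => i _; rewrite (linfun0 (gthcomp_linear _)).
- exists (maxn N M) => P; rewrite geq_max => /andP[/xN/eqP xP /yM/eqP yP].
  under eq_bigr do rewrite (linfunD (gthcomp_linear _)).
  by rewrite big_split /= -xP -yP.
exists (p + q).+1 => M pqM; rewrite (bigD1 (Ordinal pqM))//= (gthcomp_gtens _ ap bq) eqxx.
rewrite big1 ?addr0// => i /eqP ipq; rewrite (gthcomp_gtens _ ap bq).
by case: eqP => // ipqE; case: ipq; apply/val_inj.
Qed.

Lemma gthcomp1 : gthcomp 0 1 = 1.
Proof. exact: (gthcomp_gtens 0 (homog1 A) (homog1 B)). Qed.

Lemma gthcompM m n x y :
  gthcomp (m + n) (gthcomp m x * gthcomp n y) = gthcomp m x * gthcomp n y.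
Proof.
have L := linfunD (gthcomp_linear _); have L0 := linfun0 (gthcomp_linear _).
elim/gtensor_ind: x => [|x x' IH IH'|p q a b ap bq].
- by rewrite L0 mul0r L0.
- by rewrite L mulrDl L IH IH'.
elim/gtensor_ind: y => [|y y' IH IH'|p' q' a' b' ap' bq'].
- by rewrite L0 mulr0 L0.
- by rewrite L mulrDr L IH IH'.
rewrite (gthcomp_gtens _ ap bq) (gthcomp_gtens _ ap' bq').
case: eqP => [->|_]; last by rewrite mul0r L0.
case: eqP => [->|_]; last by rewrite mulr0 L0.
rewrite (gtensM _ _ bq ap') (linfunZ (gthcomp_linear _)).
by rewrite (gthcomp_gtens _ (homogM ap ap') (homogM bq bq')) addnACA eqxx.
Qed.

HB.instance Definition _ := isGradedAlgebra.Build k T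
  gthcomp_linear gthcompK gthcomp_sum gthcomp1 gthcompM.

(* d (x) id + (-1)^|.| id (x) d, see [gtdif_gtens]. *)
Definition gtdif x : T :=
  tlift (fun a b => gtens (dif a) b +
    gsum (fun p a => (-1) ^+ p *: gtens a (dif b)) a) x.

Let gtdifB : bilin (fun a b => gtens (dif a) b +
    gsum (fun p a => (-1) ^+ p *: gtens a (dif b)) a).
Proof.
split=> [b|a]; apply: linear_add.
- by move=> c u v; rewrite dif_linear gtensB.1.
- by apply: gsum_linear => p; apply: linear_scale (gtensB.1 _).
- exact: gtensB.2.
- apply: gsum_linear2 => p a0; apply: linear_scale => c u v.
  by rewrite dif_linear gtensB.2.
Qed.

Lemma gtdif_linear : linear gtdif.
Proof. exact: tlift_linear. Qed.

Lemma gtdif_gtens p a b : homog p a ->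
  gtdif (gtens a b) = gtens (dif a) b + (-1) ^+ p *: gtens a (dif b).
Proof.
move=> ap; rewrite /gtdif tliftE// (gsum_homog _ ap)// => n.
by apply: linear_scale (gtensB.1 _).
Qed.

Lemma homog_dif (C : dgAlgType k) n (x : C) : homog n x -> homog n.+1 (dif x).
Proof. by move=> <-; rewrite /homog /= dif_hcomp. Qed.

Lemma homog_gtens p q a b : homog p a -> homog q b -> homog (p + q) (gtens a b).
Proof. by move=> ap bq; rewrite /homog /= [hcomp _ _](gthcomp_gtens _ ap bq) eqxx. Qed.

Let homogD (C : gradedAlgType k) n (x y : C) : homog n x -> homog n y -> homog n (x + y).
Proof. by rewrite /homog /= (linfunD (hcomp_linear _)) => -> ->. Qed.

Let homogZ (C : gradedAlgType k) n c (x : C) : homog n x -> homog n (c *: x).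
Proof. by rewrite /homog /= (linfunZ (hcomp_linear _)) => ->. Qed.

Lemma gtdif_hcomp n x : hcomp n.+1 (gtdif (hcomp n x)) = gtdif (hcomp n x).
Proof.
elim/gtensor_ind: x => [|x x' IH IH'|p q a b ap bq].
- by rewrite !(linfun0 (hcomp_linear _), linfun0 gtdif_linear).
- by rewrite !(linfunD (hcomp_linear _), linfunD gtdif_linear) IH IH'.
rewrite [hcomp n (gtens a b)](gthcomp_gtens _ ap bq); case: eqP => [->|_]; last first.
  by rewrite !(linfun0 (hcomp_linear _), linfun0 gtdif_linear).
rewrite (gtdif_gtens _ ap); apply: homogD.
  by rewrite -addSn; apply: homog_gtens => //; apply: homog_dif.
by apply: homogZ; rewrite -addnS; apply: homog_gtens => //; apply: homog_dif.
Qed.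

Lemma gtdif_dif x : gtdif (gtdif x) = 0.
Proof.
elim/gtensor_ind: x => [|x x' IH IH'|p q a b ap bq].
- by rewrite !(linfun0 gtdif_linear).
- by rewrite !(linfunD gtdif_linear) IH IH' addr0.
rewrite (gtdif_gtens _ ap) (linfunD gtdif_linear) (linfunZ gtdif_linear).
rewrite (gtdif_gtens _ ap) (gtdif_gtens _ (homog_dif ap)) !dif_dif.
rewrite (bilin0l gtensB) (bilin0r gtensB) scaler0 addr0 add0r.
by rewrite exprS mulN1r scaleNr addNr.
Qed.

Lemma gtdif_leibniz n x y :
  gtdif (hcomp n x * y) = gtdif (hcomp n x) * y + (-1) ^+ n *: (hcomp n x * gtdif y).
Proof.
have L := linfunD (hcomp_linear _); have L0 := linfun0 (hcomp_linear _).
have D := linfunD gtdif_linear; have D0 := linfun0 gtdif_linear.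
elim/gtensor_ind: x => [|x x' IH IH'|p q a b ap bq].
- by rewrite L0 mul0r D0 !mul0r scaler0 addr0.
- by rewrite L mulrDl !D IH IH' !mulrDl scalerDr addrACA.
rewrite [hcomp n (gtens a b)](gthcomp_gtens _ ap bq); case: eqP => [->|_]; last first.
  by rewrite mul0r !D0 !mul0r scaler0 addr0.
elim/gtensor_ind: y => [|y y' IH IH'|r s a' b' ar bs].
- by rewrite mulr0 !D0 !mulr0 scaler0 addr0.
- by rewrite mulrDr !D IH IH' !mulrDr scalerDr addrACA.
rewrite (gtensM _ _ bq ar) (linfunZ gtdif_linear) (gtdif_gtens _ (homogM ap ar)).
rewrite (gtdif_gtens _ ap) (gtdif_gtens _ ar) mulrDl mulrDr -scalerAl -scalerAr.
rewrite (gtensM _ _ bq ar) (gtensM _ _ (homog_dif bq) ar).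
rewrite (gtensM _ _ bq (homog_dif ar)) (gtensM _ _ bq ar).
have da : dif (a * a') = dif a * a' + (-1) ^+ p *: (a * dif a').
  by have := dif_leibniz p a a'; rewrite ap.
have db : dif (b * b') = dif b * b' + (-1) ^+ q *: (b * dif b').
  by have := dif_leibniz q b b'; rewrite bq.
rewrite da db (bilinDl gtensB) (bilinDr gtensB) (bilinZl gtensB) (bilinZr gtensB).
rewrite !scalerDr !scalerA -!exprD -addrA -[in RHS]addrA; congr (_ + _).
rewrite addrCA; congr (_ *: _ + (_ *: _ + _ *: _)); apply: sgnrE;
by rewrite !(oddD, oddM, oddS) /=; case: (odd p); case: (odd q); case: (odd r).
Qed.

HB.instance Definition _ := isDGAlgebra.Build k T
  gtdif_linear gtdif_hcomp gtdif_dif gtdif_leibniz.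

End GradedTensor.

Section Associator.
Variables (k : fieldType) (U V W : lmodType k).

Definition tassoc (x : tensor (tensor U V) W) : tensor U (tensor V W) :=
  tlift (fun y w => tlift (fun u v => u ⊗ (v ⊗ w)) y) x.

Let assoc2B (w : W) : bilin (fun (u : U) (v : V) => u ⊗ (v ⊗ w)).
Proof.
by split=> [v|u] a x y; rewrite ?(tens_bilin _ _).1// (tens_bilin _ _).2.
Qed.

Let assoc3B : bilin (fun y (w : W) => tlift (fun (u : U) (v : V) => u ⊗ (v ⊗ w)) y).
Proof.
split=> [w|y]; first exact: tlift_linear.
move=> a w w'; move: y; apply: tensor_ext => [||u v].
- exact: tlift_linear.
- by apply: linear_add; first apply: linear_scale; apply: tlift_linear.
- by rewrite !tliftE// !(tens_bilin _ _).2.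
Qed.

Lemma tassoc_linear : linear tassoc.
Proof. exact: tlift_linear. Qed.

Lemma tassocE u v w : tassoc (u ⊗ v ⊗ w) = u ⊗ (v ⊗ w).
Proof. by rewrite /tassoc !tliftE. Qed.

End Associator.

(* h |-> tlift f (coproduct h) is h |-> f(h_1, h_2) in Sweedler notation. *)
HB.mixin Record isHopfAlgebra (k : fieldType) H of GRing.Algebra k H := {
  coproduct : {lrmorphism H -> tensor H H};
  counit : {lrmorphism H -> k^o};
  antipode : {linear H -> H};
  coproductA : forall h : H,
    tassoc (tmap coproduct id (coproduct h)) = tmap id coproduct (coproduct h);
  counitl : forall h : H, tlift (fun a b => counit a *: b) (coproduct h) = h;
  counitr : forall h : H, tlift (fun a b => counit b *: a) (coproduct h) = h;
  antipodel : forall h : H, tlift (fun a b => antipode a * b) (coproduct h) = (counit h)%:A;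
  antipoder : forall h : H, tlift (fun a b => a * antipode b) (coproduct h) = (counit h)%:A
}.
#[short(type="hopfAlgType")]
HB.structure Definition HopfAlgebra (k : fieldType) :=
  {H of GRing.Algebra k H & isHopfAlgebra k H}.

Section Coactions.
Variables (k : fieldType) (H : hopfAlgType k) (V : lmodType k).
Local Notation Δ := (coproduct : H -> tensor H H).
Local Notation ε := (counit : H -> k^o).

Definition right_coaction (rho : V -> tensor V H) : Prop :=
  [/\ linear rho,
      forall v, tassoc (tmap rho id (rho v)) = tmap id Δ (rho v) &
      forall v, tlift (fun u h => ε h *: u) (rho v) = v].

Definition left_coaction (lam : V -> tensor H V) : Prop :=
  [/\ linear lam,
      forall v, tassoc (tmap Δ id (lam v)) = tmap id lam (lam v) &
      forall v, tlift (fun h u => ε h *: u) (lam v) = v].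

End Coactions.

Record leftModule (k : fieldType) (R : algType k) := LeftModule {
  lmod_car :> lmodType k;
  lact : R -> lmod_car -> lmod_car;
  lact_bilin : bilin lact;
  lact1 : forall m, lact 1 m = m;
  lactA : forall r s m, lact r (lact s m) = lact (r * s) m }.

Record rightModule (k : fieldType) (R : algType k) := RightModule {
  rmod_car :> lmodType k;
  ract : rmod_car -> R -> rmod_car;
  ract_bilin : bilin ract;
  ract1 : forall m, ract m 1 = m;
  ractA : forall m r s, ract (ract m r) s = ract m (r * s) }.

Record bimodule (k : fieldType) (R : algType k) := Bimodule {
  bimod_car :> lmodType k;
  blact : R -> bimod_car -> bimod_car;
  bract : bimod_car -> R -> bimod_car;
  blact_bilin : bilin blact;
  bract_bilin : bilin bract;
  blact1 : forall m, blact 1 m = m;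
  bract1 : forall m, bract m 1 = m;
  blactA : forall r s m, blact r (blact s m) = blact (r * s) m;
  bractA : forall m r s, bract (bract m r) s = bract m (r * s);
  bactA : forall r m s, bract (blact r m) s = blact r (bract m s) }.

Definition bimod_left (k : fieldType) (R : algType k) (M : bimodule R) : leftModule R :=
  LeftModule (@blact_bilin _ _ M) (@blact1 _ _ M) (@blactA _ _ M).

Definition right_regular (k : fieldType) (R : algType k) : rightModule R :=
  RightModule (mul_bilin R) (@mulr1 R) (fun x y z => esym (mulrA x y z)).

(* M (x)_R N as the quotient of M (x) N over the base field by
   (m r) (x) n - m (x) (r n). *)
Section BalancedTensor.
Variables (k : fieldType) (R : algType k) (M : rightModule R) (N : leftModule R).

Definition balance_rel : set (tensor M N) :=
  [set x | exists m r n, x = ract m r ⊗ n - m ⊗ lact r n].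

Definition btensor : Type := lquot balance_rel.
HB.instance Definition _ := GRing.Lmodule.on btensor.

Definition btens (m : M) (n : N) : btensor := lqpi balance_rel (m ⊗ n).

Lemma btens_bilin : bilin btens.
Proof.
by apply: (linear_bilin (g := lqpi balance_rel)) (tens_bilin _ _) => a x y; rewrite linearP.
Qed.

Lemma btens_balanced m r n : btens (ract m r) n = btens m (lact r n).
Proof.
apply/subr0_eq; rewrite /btens -linearB /=; apply/lqpi_eq0/lspan_in.
by exists m, r, n.
Qed.

Definition balanced (W : lmodType k) (f : M -> N -> W) : Prop :=
  bilin f /\ forall m r n, f (ract m r) n = f m (lact r n).

Definition btlift (W : lmodType k) (f : M -> N -> W) : btensor -> W :=
  lqlift (tlift f).

Section Lift.
Variables (W : lmodType k) (f : M -> N -> W).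
Hypothesis fB : balanced f.

Let fL : linear (tlift f). Proof. exact: tlift_linear fB.1. Qed.
Let f0 x : balance_rel x -> tlift f x = 0.
Proof.
move=> [m [r [n ->]]]; rewrite -scaleN1r addrC fL !tliftE; do ?exact: fB.1.
by rewrite fB.2 scaleN1r addNr.
Qed.

Lemma btlift_linear : linear (btlift f).
Proof. exact: lqlift_linear. Qed.

Lemma btliftE m n : btlift f (btens m n) = f m n.
Proof. by rewrite /btlift lqliftE// tliftE//; exact: fB.1. Qed.

End Lift.

Lemma btensor_ext (W : lmodType k) (f g : btensor -> W) : linear f -> linear g ->
  (forall m n, f (btens m n) = g (btens m n)) -> f =1 g.
Proof.
move=> fL gL fg x; have [y ->] := lqpi_surj x; move: y.
apply: (@tensor_ext _ _ _ _ (f \o lqpi balance_rel) (g \o lqpi balance_rel)) => [||//] a u v;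
by rewrite /= linearP ?fL ?gL.
Qed.

End BalancedTensor.

Section BalancedTensorRight.
Variables (k : fieldType) (R : algType k) (M : rightModule R) (N : bimodule R).
Local Notation T := (btensor M (bimod_left N)).

Definition bt_ract (x : T) (r : R) : T :=
  btlift (fun (m : M) (n : bimod_left N) => btens m (bract n r : bimod_left N)) x.

Let bt_ract_bal r :
  balanced (fun (m : M) (n : bimod_left N) => btens m (bract n r : bimod_left N)).
Proof.
split; first by apply: bilin_comp (btens_bilin _ _) _ _; [|exact: (bract_bilin N).1].
by move=> m s n; rewrite btens_balanced /= bactA.
Qed.

Let bt_ractE m (n : N) r : bt_ract (btens m (n : bimod_left N)) r = btens m (bract n r : bimod_left N).
Proof. by rewrite /bt_ract btliftE. Qed.

Lemma bt_ract_bilin : bilin bt_ract.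
Proof.
split=> [r|x]; first exact: btlift_linear.
move=> a r s; move: x; apply: btensor_ext => [||m n].
- exact: btlift_linear.
- by apply: linear_add; first apply: linear_scale; apply: btlift_linear.
- by rewrite !bt_ractE (bract_bilin N).2 (btens_bilin _ _).2.
Qed.

Lemma bt_ract1 x : bt_ract x 1 = x.
Proof.
move: x; apply: btensor_ext => [|//|m n]; first exact: btlift_linear.
by rewrite bt_ractE bract1.
Qed.

Lemma bt_ractA x r s : bt_ract (bt_ract x r) s = bt_ract x (r * s).
Proof.
move: x; apply: btensor_ext => [||m n]; last by rewrite !bt_ractE bractA.
  by apply: (@linear_comp _ _ _ _ (bt_ract^~ s) (bt_ract^~ r)); apply: btlift_linear.
exact: btlift_linear.
Qed.

Definition btensor_right : rightModule R := RightModule bt_ract_bilin bt_ract1 bt_ractA.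

End BalancedTensorRight.

Section Flatness.
Variables (k : fieldType) (R : algType k).

Definition rmod_morphism (M M' : rightModule R) (f : M -> M') : Prop :=
  linear f /\ forall m r, f (ract m r) = ract (f m) r.

Definition btmap (M M' : rightModule R) (N : leftModule R) (f : M -> M') :
  btensor M N -> btensor M' N := btlift (fun m n => btens (f m) n).

Definition exact_at (U V W : lmodType k) (f : U -> V) (g : V -> W) : Prop :=
  forall v, g v = 0 <-> exists u, f u = v.

(* - (x)_R N preserves and reflects exactness. *)
Definition faithfully_flat (N : leftModule R) : Prop :=
  forall (M1 M2 M3 : rightModule R) (f : M1 -> M2) (g : M2 -> M3),
    rmod_morphism f -> rmod_morphism g ->
    exact_at f g <-> exact_at (@btmap M1 M2 N f) (@btmap M2 M3 N g).

End Flatness.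

Section HopfGalois.
Variables (k : fieldType) (H : hopfAlgType k) (A : algType k).
Variable delta : {lrmorphism A -> tensor A H}.

(* B = A^{co H}. *)
Definition coinv_pred : {pred A} := fun a => `[< delta a = a ⊗ 1 >].

Lemma coinv_subalg_closed : subalg_closed coinv_pred.
Proof.
split=> [|c a b /asboolP ea /asboolP eb|a b /asboolP ea /asboolP eb]; apply/asboolP.
- by rewrite rmorph1.
- by rewrite linearP /= ea eb (tens_bilin _ _).1.
- by rewrite rmorphM /= ea eb tensM mulr1.
Qed.

Record coinvariants := Coinvariant { coinv_val :> A; _ : coinv_val \in coinv_pred }.

HB.instance Definition _ := [isSub for coinv_val].
HB.instance Definition _ := [Choice of coinvariants by <:].
HB.instance Definition _ := GRing.SubChoice_isSubAlgebra.Build k A coinv_pred coinvariants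
  coinv_subalg_closed.

Let coinv_linear : linear coinv_val.
Proof. by move=> c a b; exact: (linearP (\val : coinvariants -> A)). Qed.

Lemma total_lact_bilin : bilin (fun (b : coinvariants) (a : A) => (b : A) * a).
Proof. exact: (bilin_comp (mul_bilin A) coinv_linear (@linear_id _ _)). Qed.
Lemma total_lact1 (a : A) : ((1 : coinvariants) : A) * a = a.
Proof. by rewrite [coinv_val 1](rmorph1 (\val : coinvariants -> A)) mul1r. Qed.
Lemma total_lactA (b c : coinvariants) (a : A) : (b : A) * ((c : A) * a) = ((b * c : coinvariants) : A) * a.
Proof. by rewrite [coinv_val (b * c)](rmorphM (\val : coinvariants -> A)) mulrA. Qed.

Definition total_left : leftModule coinvariants :=
  @LeftModule k coinvariants A (fun b a => coinv_val b * a)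
    total_lact_bilin total_lact1 total_lactA.

Lemma total_ract_bilin : bilin (fun (a : A) (b : coinvariants) => a * (b : A)).
Proof. exact: (bilin_comp (mul_bilin A) (@linear_id _ _) coinv_linear). Qed.
Lemma total_ract1 (a : A) : a * ((1 : coinvariants) : A) = a.
Proof. by rewrite [coinv_val 1](rmorph1 (\val : coinvariants -> A)) mulr1. Qed.
Lemma total_ractA (a : A) (b c : coinvariants) : (a * (b : A)) * (c : A) = a * ((b * c : coinvariants) : A).
Proof. by rewrite [coinv_val (b * c)](rmorphM (\val : coinvariants -> A)) mulrA. Qed.

Definition total_right : rightModule coinvariants :=
  @RightModule k coinvariants A (fun a b => a * coinv_val b)
    total_ract_bilin total_ract1 total_ractA.

(* a (x)_B a' |-> a a'_0 (x) a'_1, see [canonical_mapE]. *)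
Definition canonical_map : btensor total_right total_left -> tensor A H :=
  btlift (fun (a : total_right) (a' : total_left) => ((a : A) ⊗ 1) * delta a').

Lemma canonical_mapE (a a' : A) :
  canonical_map (btens (a : total_right) (a' : total_left)) = (a ⊗ 1) * delta a'.
Proof.
apply: btliftE; split.
  apply: (bilin_comp (mul_bilin _) (g := fun a : A => a ⊗ (1 : H)) (h := delta)).
    exact: (tens_bilin _ _).1.
  by move=> c x y; rewrite linearP.
move=> m [b /asboolP eb] n /=; rewrite rmorphM /= eb mulrA tensM.
by rewrite mulr1.
Qed.

Definition hopf_galois : Prop := bijective canonical_map.

(* [delta] is an algebra morphism, so [right_coaction delta] makes A a right
   H-comodule algebra; A is taken faithfully flat as a left B-module. *)
Definition quantum_principal_bundle : Prop :=
  [/\ right_coaction delta, hopf_galois & faithfully_flat total_left].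

End HopfGalois.

Record fodc (k : fieldType) (A : algType k) := Fodc {
  fodc_forms :> bimodule A;
  fodc_d : A -> fodc_forms;
  fodc_d_linear : linear fodc_d;
  fodc_leibniz : forall a b, fodc_d (a * b) = bract (fodc_d a) b + blact a (fodc_d b);
  fodc_span : forall w, lspan [set x | exists a b, x = blact a (fodc_d b)] w }.

Section Bicovariant.
Variables (k : fieldType) (H : hopfAlgType k) (Gamma : fodc H).
Local Notation Δ := (coproduct : H -> tensor H H).
Local Notation d := (@fodc_d _ _ Gamma).

Definition left_covariant (lam : Gamma -> tensor H Gamma) : Prop :=
  [/\ left_coaction lam,
      forall h w, lam (blact h w) = tmap2 *%R (@blact _ _ Gamma) (Δ h) (lam w),
      forall w h, lam (bract w h) = tmap2 *%R (@bract _ _ Gamma) (lam w) (Δ h) &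
      forall h, lam (d h) = tmap id d (Δ h)].

Definition right_covariant (rho : Gamma -> tensor Gamma H) : Prop :=
  [/\ right_coaction rho,
      forall h w, rho (blact h w) = tmap2 (@blact _ _ Gamma) *%R (Δ h) (rho w),
      forall w h, rho (bract w h) = tmap2 (@bract _ _ Gamma) *%R (rho w) (Δ h) &
      forall h, rho (d h) = tmap d id (Δ h)].

Definition bicovariant : Prop :=
  exists (lam : Gamma -> tensor H Gamma) (rho : Gamma -> tensor Gamma H),
    [/\ left_covariant lam, right_covariant rho &
        forall w, tassoc (tmap lam id (rho w)) = tmap id rho (lam w)].

End Bicovariant.

(* [dc_inc] identifies A with the degree 0 part. *)
Record diffCalculus (k : fieldType) (A : algType k) := DiffCalculus {
  dc_forms :> dgAlgType k;
  dc_inc : {lrmorphism A -> dc_forms};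
  dc_inc_inj : injective dc_inc;
  dc_inc_image : range dc_inc = homog 0;
  dc_span : forall n (w : dc_forms), homog n w ->
    lspan [set x | exists (a0 : A) (a : 'I_n -> A),
             x = dc_inc a0 * \prod_(i < n) dif (dc_inc (a i))] w }.

Record dgMorphism (k : fieldType) (A B : dgAlgType k) := DGMorphism {
  dgm_fun :> {lrmorphism A -> B};
  dgm_homog : forall n x, homog n x -> homog n (dgm_fun x);
  dgm_dif : forall x, dgm_fun (dif x) = dif (dgm_fun x) }.

Section MaximalProlongation.
Variables (k : fieldType) (H : algType k) (Gamma : fodc H).
Local Notation d := (@fodc_d _ _ Gamma : H -> bimod_left Gamma).

(* tpow n = H (x)_H Gamma (x)_H ... (x)_H Gamma (n factors Gamma) is the degree n
   part of the tensor algebra T of Gamma over H; [tapp x w] is x (x)_H w. *)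
Fixpoint tpow (n : nat) : rightModule H :=
  if n is m.+1 then btensor_right (tpow m) Gamma else right_regular H.

Definition tapp n (x : tpow n) (w : Gamma) : tpow n.+1 :=
  btens x (w : bimod_left Gamma).

(* Degree by degree, the two-sided ideal of T generated by the elements
   \sum_i da^i (x)_H db^i with \sum_i a^i db^i = 0: it is spanned by the
   x (x) (\sum_i da^i (x) db^i h) (x) w_1 (x) ... (x) w_j, for x in T, h in H and
   w_1, ..., w_j in Gamma. *)
Inductive prol_ideal : forall n, tpow n -> Prop :=
| prol_gen n (x : tpow n) (s : seq (H * H)) (h : H) :
    \sum_(ab <- s) blact ab.1 (fodc_d Gamma ab.2) = 0 ->
    prol_ideal (\sum_(ab <- s)
      tapp (tapp x (fodc_d Gamma ab.1)) (bract (fodc_d Gamma ab.2) h))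
| prol_app n (x : tpow n) (w : Gamma) : prol_ideal x -> prol_ideal (tapp x w)
| prol_zero n : prol_ideal (0 : tpow n)
| prol_lin n c (x y : tpow n) :
    prol_ideal x -> prol_ideal y -> prol_ideal (c *: x + y).

(* The algebra map T -> Omega extending the inclusion of H and
   theta : Gamma -> Omega^1, h dh' |-> h dh', is onto with kernel [prol_ideal];
   phi n is its restriction to tpow n. *)
Definition maximal_prolongation (Omega : diffCalculus H) : Prop :=
  exists (theta : Gamma -> Omega) (phi : forall n, tpow n -> Omega),
    [/\ linear theta /\
          forall h h' w, theta (bract (blact h w) h') =
                           dc_inc Omega h * theta w * dc_inc Omega h',
        forall h, theta (fodc_d Gamma h) = dif (dc_inc Omega h),
        (forall n, linear (@phi n)) /\
          (forall h : H, @phi 0%N h = dc_inc Omega h) /\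
          forall n (x : tpow n) w, phi n.+1 (tapp x w) = phi n x * theta w,
        forall n, range (@phi n) = homog n &
        forall n (x : tpow n), phi n x = 0 <-> prol_ideal x].

End MaximalProlongation.

Section Extension.
Variables (k : fieldType) (A B C : algType k).
Variables (OA : diffCalculus A) (OB : diffCalculus B) (OC : diffCalculus C).

(* F restricts to f on degree 0. *)
Definition extends (f : A -> tensor B C) (F : OA -> gtensor OB OC) : Prop :=
  forall a, F (dc_inc OA a) = tmap (dc_inc OB) (dc_inc OC) (f a).

End Extension.

Section Horizontal.
Variables (k : fieldType) (A : algType k) (H : algType k).
Variables (OA : diffCalculus A) (OH : diffCalculus H).
Variable deltaw : OA -> gtensor OA OH.

(* The preimage of Omega(A) (x) H, where H = Omega^0(H). *)
Definition hor : set OA := deltaw @^-1` range (tmap id (dc_inc OH)).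

Definition hor_deg (n : nat) : set OA := hor `&` homog n.

End Horizontal.

Definition graded_subalgebra (k : fieldType) (A : gradedAlgType k) (S : set A) : Prop :=
  [/\ S 1, forall c x y, S x -> S y -> S (c *: x + y),
      forall x y, S x -> S y -> S (x * y) &
      forall n x, S x -> S (hcomp n x)].

(* Main.v *)
Require Import Defs.
From mathcomp Require Import all_boot all_order all_algebra.
From mathcomp Require Import boolp classical_sets.

(** Horizontality is a condition on the second leg of the coaction: it has to
    lie in degree zero. This makes the statement a formal consequence of two
    facts.

    - The subspace Omega(A) (x) H of Omega(A) (x) Omega(H) is a graded
      subalgebra. The Koszul sign in a product (w (x) h)(w' (x) h') is
      (-1)^(|h||w'|), and |h| = 0, so the inclusion of the ordinary tensor
      product algebra Omega(A) (x) H is multiplicative ([inc_rightM]); and the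
      degree of w (x) h is that of w, so taking a homogeneous component only
      touches the first leg ([hcomp_inc_right]).
    - The extended coaction is an algebra morphism of degree zero, hence
      commutes with taking homogeneous components ([graded_map_hcomp]), and the
      preimage of a graded subalgebra under such a morphism is again a graded
      subalgebra ([graded_subalgebra_preimage]).

    The product of horizontal forms of degrees k and l is then horizontal, and
    has degree k + l because the product of Omega(A) is graded. *)

Set Implicit Arguments.
Unset Strict Implicit.
Unset Printing Implicit Defensive.

Import GRing.Theory.
Local Open Scope ring_scope.
Local Open Scope classical_set_scope.

Lemma graded_map_hcomp (k : fieldType) (A B : gradedAlgType k) (f : A -> B) :
  linear f -> (forall n x, homog n x -> homog n (f x)) ->
  forall n x, f (hcomp n x) = hcomp n (f x).
Proof.
move=> fL fh n; elim/homog_ind => [|x y IHx IHy|m x xm].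
- by rewrite !(linfun0 (hcomp_linear _), linfun0 fL).
- by rewrite !(linfunD (hcomp_linear _), linfunD fL) IHx IHy.
rewrite (homog_hcomp _ xm) (homog_hcomp _ (fh _ _ xm)).
by case: eqP => // _; apply: linfun0.
Qed.

Lemma graded_subalgebra_preimage (k : fieldType) (A B : gradedAlgType k)
    (f : {lrmorphism A -> B}) (S : set B) :
  (forall n x, homog n x -> homog n (f x)) ->
  graded_subalgebra S -> graded_subalgebra (f @^-1` S).
Proof.
move=> fh [S1 SL SM Sh]; split=> [|c x y Sx Sy|x y Sx Sy|n x Sx]; rewrite /preimage /=.
- by rewrite rmorph1.
- by rewrite linearP; apply: SL.
- by rewrite rmorphM; apply: SM.
- by rewrite (graded_map_hcomp _ fh); [apply: Sh|move=> c u v; exact: linearP].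
Qed.

Section DegreeZeroOnTheRight.
Variables (k : fieldType) (Omega : dgAlgType k) (H : algType k) (OH : diffCalculus H).

(** The source carries the unsigned tensor product algebra structure, the
    target the Koszul-signed one. *)
Definition inc_right : tensor Omega H -> gtensor Omega OH := tmap id (dc_inc OH).

Lemma dc_inc_linear : linear (dc_inc OH).
Proof. by move=> c x y; rewrite linearP. Qed.

Lemma inc_right_linear : linear inc_right.
Proof. exact: tmap_linear (@linear_id _ _) dc_inc_linear. Qed.

Lemma inc_rightE w h : inc_right (w ⊗ h) = gtens w (dc_inc OH h).
Proof. exact: tmapE (@linear_id _ _) dc_inc_linear. Qed.

Lemma homog_dc_inc h : homog 0 (dc_inc OH h).
Proof. by rewrite -dc_inc_image; exists h. Qed.

(** Moving the degree zero form h past w' costs no sign. *)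
Lemma inc_rightM x y : inc_right (x * y) = inc_right x * inc_right y.
Proof.
have D := linfunD inc_right_linear; have L0 := linfun0 inc_right_linear.
elim/tensor_ind: x => [|x x' IH IH'|w h].
- by rewrite mul0r L0 mul0r.
- by rewrite mulrDl !D IH IH' mulrDl.
elim/tensor_ind: y => [|y y' IH IH'|w' h'].
- by rewrite mulr0 L0 mulr0.
- by rewrite mulrDr !D IH IH' mulrDr.
elim/homog_ind: w' => [|w1 w2 IH1 IH2|n w' w'n].
- by rewrite (bilin0l (tens_bilin Omega H)) mulr0 L0 mulr0.
- by rewrite (bilinDl (tens_bilin Omega H)) mulrDr !D IH1 IH2 mulrDr.
rewrite tensM !inc_rightE (gtensM _ _ (homog_dc_inc h) w'n).
by rewrite mul0n expr0 scale1r rmorphM.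
Qed.

Lemma hcomp_inc_right n x : hcomp n (inc_right x) = inc_right (tmap (hcomp n) id x).
Proof.
have hL : linear (hcomp n : Omega -> Omega) := hcomp_linear n.
have tL := tmap_linear hL (@linear_id _ H).
move: x; apply: tensor_ext => [||w h].
- exact: linear_comp (hcomp_linear n) inc_right_linear.
- exact: linear_comp inc_right_linear tL.
rewrite (tmapE _ _ hL (@linear_id _ H)).
have D := linfunD inc_right_linear; have L0 := linfun0 inc_right_linear.
elim/homog_ind: w => [|w1 w2 IH1 IH2|m w wm].
- by rewrite (linfun0 hL) (bilin0l (tens_bilin Omega H)) L0 (linfun0 (hcomp_linear n)).
- rewrite (linfunD hL) !(bilinDl (tens_bilin Omega H)) !D.
  by rewrite (linfunD (hcomp_linear n)) IH1 IH2.
rewrite (homog_hcomp _ wm) inc_rightE.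
rewrite [LHS](gthcomp_gtens _ wm (homog_dc_inc h)) addn0.
case: eqP => _; first by rewrite inc_rightE.
by rewrite (bilin0l (tens_bilin Omega H)) L0.
Qed.

Lemma graded_subalgebra_inc_right : graded_subalgebra (range inc_right).
Proof.
split.
- by exists (1 ⊗ 1) => //; rewrite inc_rightE rmorph1.
- move=> c _ _ [x _ <-] [y _ <-]; exists (c *: x + y) => //.
  exact: inc_right_linear.
- by move=> _ _ [x _ <-] [y _ <-]; exists (x * y) => //; exact: inc_rightM.
- by move=> n _ [x _ <-]; exists (tmap (hcomp n) id x) => //; rewrite hcomp_inc_right.
Qed.

End DegreeZeroOnTheRight.

Theorem proposition4p2p13 (kk : fieldType)
  (* H and the maximal prolongation of a bicovariant first order calculus *)
  (H : hopfAlgType kk) (Gamma : fodc H) (Gamma_bicov : bicovariant Gamma)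
  (OH : diffCalculus H) (OH_max : maximal_prolongation Gamma OH)
  (OH_coproduct : exists F : dgMorphism OH (gtensor OH OH),
     extends (coproduct : H -> tensor H H) F)
  (* the quantum principal bundle A^{co H} in A *)
  (A : algType kk) (delta : {lrmorphism A -> tensor A H})
  (A_qpb : quantum_principal_bundle delta)
  (* a complete calculus on A: deltaw is the extension of delta *)
  (OA : diffCalculus A) (deltaw : dgMorphism OA (gtensor OA OH))
  (OA_complete : extends delta deltaw) :
  graded_subalgebra (hor deltaw) /\
  (forall (k l : nat) (w g : OA),
     hor_deg deltaw k w -> hor_deg deltaw l g -> hor_deg deltaw (k + l) (w * g)).
Proof.
have hor_alg : graded_subalgebra (hor deltaw).
  apply: graded_subalgebra_preimage; first exact: dgm_homog.
  exact: graded_subalgebra_inc_right.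
split=> // n l w g [hw wn] [hg gl]; case: hor_alg => _ _ horM _.
by split; [apply: horM|apply: homogM].
Qed.
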